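(* Let $M$ be a one-dimensional complex manifold, $G$ a connected complex semisimple Lie group of rank $r$, $\varphi_-:M\to F_-=G/B_+$ a holomorphic mapping, and $\Phi_i=\varphi_-^*\pi_{-i}^*\iota_{F_{-i}}^*\Phi_i^{FS}$, $i=1,\dots,r$. Any holomorphic local lift $\tilde\varphi_-$ of $\varphi_-$ to $G$ (a holomorphic mapping from an open subset of $M$ to $G$ with $\pi_-\circ\tilde\varphi_-=\varphi_-$ there) leads to the local representation $$\Phi_i=-2\sqrt{-1}\,\partial\bar\partial\ln\|\tilde\varphi_-v_i\|^2$$ on the domain of $\tilde\varphi_-$, where $\|\tilde\varphi_-v_i\|^2(p)=\langle\rho_i(\tilde\varphi_-(p))v_i,\rho_i(\tilde\varphi_-(p))v_i\rangle$.
   Context: Lie algebra data: $\mathfrak g$ is the Lie algebra of $G$, $\mathfrak h$ a Cartan subalgebra, and $h_i,x_{\pm i}$ ($i=1,\dots,r$) Cartan and Chevalley generators, with $[h_i,x_{\pm j}]=\pm k_{ji}x_{\pm j}$, $[x_{+i},x_{-j}]=\delta_{ij}h_i$, $k$ the Cartan matrix. $B_+$ is the Borel subgroup with Lie algebra $\mathfrak b_+$ spanned by $\mathfrak h$ and the positive root spaces; $\pi_-:G\to F_-=G/B_+$ is the projection. $\rho_i:G\to GL(V_i)$, $i=1,\dots,r$, are the fundamental representations (assumed to be defined on $G$), with highest weight vector $v_i\in V_i$: $\rho_i(h_j)v_i=\delta_{ij}v_i$, $\rho_i(x_{+j})v_i=0$. Each $V_i$ carries a hermitian scalar product $\langle\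 ,\ \rangle$. $P_{+i'}\supset B_+$ is the maximal parabolic subgroup whose Lie algebra is generated by $\mathfrak b_+$ and the $x_{-j}$, $j\neq i$; it is the stabilizer of the point $p_i\in\mathbb P(V_i)$ represented by $v_i$. $F_{-i}=G/P_{+i'}$, $\pi_{-i}:F_-\to F_{-i}$, $gB_+\mapsto gP_{+i'}$, and $\iota_{F_{-i}}:F_{-i}\to\mathbb P(V_i)$, $gP_{+i'}\mapsto g\cdot p_i$. $\Phi_i^{FS}$ is the fundamental form of the Fubini–Study metric on $\mathbb P(V_i)$, the unique form with $\mathrm{pr}_i^*\Phi_i^{FS}=-2\sqrt{-1}\,\partial\bar\partial\ln\|v\|^2$, where $\mathrm{pr}_i:V_i\setminus\{0\}\to\mathbb P(V_i)$ is the projection. *)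

(* Defs.v *)
From HB Require Import structures.
From mathcomp Require Import all_boot all_order all_algebra.
From mathcomp Require Import sesquilinear.
From mathcomp Require Import all_classical all_reals all_analysis.
From mathcomp Require Import complex.
Set Implicit Arguments.
Unset Strict Implicit.
Unset Printing Implicit Defensive.
Import Order.TTheory GRing.Theory Num.Theory.
Import numFieldNormedType.Exports VectorInternalTheory.
Local Open Scope classical_set_scope.
Local Open Scope ring_scope.
Local Open Scope complex_scope.

(* The library provides no normed structure on R[i] itself, only on its
   regular module R[i]^o. *)
#[non_forgetful_inheritance]
HB.instance Definition _ (R : realType) := GRing.ComAlgebra.copy R[i] R[i]^o.
#[non_forgetful_inheritance]
HB.instance Definition _ (R : realType) := Vector.copy R[i] R[i]^o.
#[non_forgetful_inheritance]
HB.instance Definition _ (R : realType) := NormedModule.copy R[i] R[i]^o.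

Section Calculus.
Context {R : realType}.
Local Notation C := R[i].

Fixpoint cdiff_order {V W : normedModType C} (k : nat) (U : set V)
    (f : V -> W) : Prop :=
  if k is k'.+1 then
    (forall x, U x -> differentiable f x) /\
    (forall v, cdiff_order k' U (fun x => 'D_v f x))
  else True.

(* Differentiability is over the field C.  A holomorphic map is taken to be a
   C^oo map satisfying the Cauchy-Riemann equations (the definition of
   Griffiths and Harris), that is, a map with complex derivatives of all
   orders. *)
Definition holomorphic_on {V W : normedModType C} (U : set V) (f : V -> W) :=
  open U /\ forall k, cdiff_order k U f.

Section Wirtinger.
Context {n : nat}.
Implicit Types (f : 'rV[C]_n -> C) (x v : 'rV[C]_n).

(* d/dt f(x + t v) at t = 0, with t real *)
Definition rderive f x v : C :=
  derive1 (fun t : R => complex.Re (f (x + t%:C *: v))) 0 +i*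
  derive1 (fun t : R => complex.Im (f (x + t%:C *: v))) 0.

Definition rderivable f x v :=
  derivable (fun t : R => complex.Re (f (x + t%:C *: v))) 0 1 /\
  derivable (fun t : R => complex.Im (f (x + t%:C *: v))) 0 1.

Fixpoint rsmooth_order (k : nat) (U : set 'rV[C]_n) f : Prop :=
  (forall x, U x -> {for x, continuous f}) /\
  if k is k'.+1 then
    forall v, (forall x, U x -> rderivable f x v) /\
      rsmooth_order k' U (fun x => rderive f x v)
  else True.

(* The (1,0)- and (0,1)-parts of df:
   sum_j (df/dz_j) v_j  and  sum_j (df/dzbar_j) conj(v_j) *)
Definition del0 f x v : C := (rderive f x v - 'i * rderive f x ('i *: v)) / 2.
Definition delbar0 f x v : C :=
  (rderive f x v + 'i * rderive f x ('i *: v)) / 2.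

(* For a (0,1)-form w = sum_k w_k dzbar_k, this is
   del w = sum_(j,k) (dw_k/dz_j) dz_j /\ dzbar_k evaluated on (u, v), with
   (a /\ b)(u, v) = a(u) b(v) - a(v) b(u). *)
Definition del1 (w : 'rV[C]_n -> 'rV[C]_n -> C) x u v : C :=
  del0 (fun y => w y v) x u - del0 (fun y => w y u) x v.

End Wirtinger.
End Calculus.

Section Manifolds.
Context {R : realType}.
Local Notation C := R[i].

Record chart (T : Type) (n : nat) := Chart {
  cdom : set T;
  cmap : T -> 'rV[C]_n;
  cinv : 'rV[C]_n -> T;
  cmapK : forall p, cdom p -> cinv (cmap p) = p
}.

(* An atlas, indexed by the points of T.  Taking p = q, chart_compat says that
   the image of every chart is open. *)
Record atlas (T : Type) := Atlas {
  adim : nat;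
  chart_at : T -> chart T adim;
  mem_chart_at : forall p, cdom (chart_at p) p;
  chart_compat : forall p q,
    holomorphic_on
      (cmap (chart_at p) @` (cdom (chart_at p) `&` cdom (chart_at q)))
      (cmap (chart_at q) \o cinv (chart_at p))
}.

Definition atop (T : Type) (A : atlas T) : Type := T.

Section Topology.
Context {T : Type} (A : atlas T).
Local Notation atop := (atop A).

HB.instance Definition _ := gen_eqMixin atop.
HB.instance Definition _ := gen_choiceMixin atop.

Definition aopen (X : set atop) :=
  forall p : T,
    open (cmap (chart_at A p) @` ((X : set T) `&` cdom (chart_at A p))).

Lemma aopenT : aopen setT.
Proof.
move=> p; rewrite setTI.
by have [+ _] := chart_compat A p p; rewrite setIid.
Qed.

Lemma aopenI : setI_closed aopen.
Proof.
move=> X Y oX oY p; set c := chart_at A p.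
rewrite (_ : _ @` _ =
  (cmap c @` ((X : set T) `&` cdom c)) `&`
  (cmap c @` ((Y : set T) `&` cdom c))); first exact: openI (oX p) (oY p).
apply/seteqP; split=> [y [x [[Xx Yx] cx] <-]|y [[x [Xx cx] <-] [z [Yz cz] e]]].
  by split; exists x.
exists x => //; split=> //; split=> //.
by rewrite -(cmapK cx) -e (cmapK cz).
Qed.

Lemma aopen_bigcup (I : Type) (f : I -> set atop) :
  (forall i, aopen (f i)) -> aopen (\bigcup_i f i).
Proof.
move=> of_ p; set c := chart_at A p.
rewrite (_ : _ @` _ = \bigcup_i (cmap c @` ((f i : set T) `&` cdom c))).
  by apply: bigcup_open => i _; exact: of_.
apply/seteqP; split=> [y [x [[i _ fx] cx] <-]|y [i _ [x [fx cx] <-]]].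
  by exists i => //; exists x.
by exists x => //; split=> //; exists i.
Qed.

HB.instance Definition _ :=
  isOpenTopological.Build atop aopenT aopenI aopen_bigcup.

End Topology.

Record complex_structure (T : Type) := ComplexStructure {
  catlas :> atlas T;
  chausdorff : hausdorff_space (atop catlas)
}.

Section Maps.
Context {S T : Type} (A : complex_structure S) (B : complex_structure T).

Definition local_rep (f : S -> T) (p : S) : 'rV[C]_(adim A) -> 'rV[C]_(adim B) :=
  cmap (chart_at B (f p)) \o f \o cinv (chart_at A p).

Definition holo_at (f : S -> T) (p : S) :=
  {for p, continuous (f : atop A -> atop B)} /\
  exists W, W (cmap (chart_at A p) p) /\ holomorphic_on W (local_rep f p).

Definition holo (f : S -> T) := forall p, holo_at f p.

(* The tangent space at p is 'rV[C]_(adim A), by means of the chart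
   chart_at A p; this is the differential of f at p. *)
Definition mderiv (f : S -> T) (p : S) :
    'rV[C]_(adim A) -> 'rV[C]_(adim B) :=
  'd (local_rep f p) (cmap (chart_at A p) p).

End Maps.
Arguments local_rep {S T} A B f p.
Arguments holo_at {S T} A B f p.
Arguments holo {S T} A B f.
Arguments mderiv {S T} A B f p.

(* A holomorphic submersion, described by its local holomorphic sections
   through every point of the source. *)
Definition submersion {S T : Type} (A : complex_structure S)
    (B : complex_structure T) (pi : S -> T) :=
  holo A B pi /\
  forall p, exists (U : set T) (s : T -> S),
    [/\ open (U : set (atop B)), U (pi p), s (pi p) = p &
        forall y, U y -> pi (s y) = y /\ holo_at B A s y].

Definition form2 {T : Type} (A : complex_structure T) :=
  T -> 'rV[C]_(adim A) -> 'rV[C]_(adim A) -> C.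

(* A value of the form at q uses the chart at q, hence the transition tr from
   the chart at p. *)
Definition form2_chart {T : Type} (A : complex_structure T) (w : form2 A)
    (p : T) (x u v : 'rV[C]_(adim A)) : C :=
  let q := cinv (chart_at A p) x in
  let tr := 'd (cmap (chart_at A q) \o cinv (chart_at A p)) x in
  w q (tr u) (tr v).

Definition is_form2 {T : Type} (A : complex_structure T) (w : form2 A) :=
  [/\ forall p u, w p u u = 0,
      forall p u u' v (a : R), w p (a%:C *: u + u') v = a%:C * w p u v + w p u' v,
      forall p u v v' (a : R), w p u (a%:C *: v + v') = a%:C * w p u v + w p u v' &
      forall p u v k, rsmooth_order k
        (cmap (chart_at A p) @` cdom (chart_at A p))
        (fun x => form2_chart w p x u v)].

Definition pullback {S T : Type} (A : complex_structure S)
    (B : complex_structure T) (f : S -> T) (w : form2 B) : form2 A :=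
  fun p u v => w (f p) (mderiv A B f p u) (mderiv A B f p v).

Definition deldelbar {T : Type} (A : complex_structure T) (h : T -> C) :
    form2 A :=
  fun p => del1 (delbar0 (h \o cinv (chart_at A p))) (cmap (chart_at A p) p).

Arguments pullback {S T} A B f w.
Arguments deldelbar {T} A h.

Section GlobalChart.
Context {T : Type} {n : nat} (f : T -> 'rV[C]_n).
Hypotheses (finj : injective f) (fopen : open (range f)).

Definition ginv (p : T) (y : 'rV[C]_n) : T :=
  if pselect (exists x, f x = y) is left h then projT1 (cid h) else p.

Lemma gK p x : ginv p (f x) = x.
Proof.
apply: finj; rewrite /ginv; case: pselect => [h|]; first exact: projT2 (cid h).
by case; exists x.
Qed.

Definition global_chart (p : T) : chart T n :=
  @Chart T n setT f (ginv p) (fun x _ => gK p x).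

Lemma diff_near_id (V : normedModType C) (g : V -> V) (x : V) :
  (\near x, g x = x) -> differentiable g x.
Proof.
move=> gx.
have e : g \o shift x = cst (g x) + idfun +o_ 0 id.
  apply/eqaddoP => _/posnumP[eps].
  have /= := gx; rewrite (near_shift 0) subr0 => gx0.
  near=> h; rewrite /= !fctE (near gx0 h) //= (nbhs_singleton gx).
  by rewrite opprD addrA addrK subrr normr0 mulr_ge0.
have c : continuous (idfun : V -> V) by move=> y; exact: cvg_id.
apply/diff_locallyP; rewrite (diff_unique (df := idfun) c e); split => //.
Unshelve. all: by end_near. Qed.

Lemma diff_near_cst (V W : normedModType C) (g : V -> W) (w : W) (x : V) :
  (\near x, g x = w) -> differentiable g x.
Proof.
move=> gx.
have e : g \o shift x = cst (g x) + (\0 : {linear V -> W}) +o_ 0 id.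
  apply/eqaddoP => _/posnumP[eps].
  have /= := gx; rewrite (near_shift 0) subr0 => gx0.
  near=> h; rewrite /= !fctE (near gx0 h) //= (nbhs_singleton gx).
  by rewrite addr0 subrr normr0 mulr_ge0.
have c : continuous (\0 : V -> W) by move=> y; exact: cvg_cst.
by apply/diff_locallyP; rewrite (diff_unique (df := \0) c e).
Unshelve. all: by end_near. Qed.

Lemma cdiff_cst (V W : normedModType C) k : forall (U : set V) (g : V -> W) (w : W),
  open U -> (forall x, U x -> g x = w) -> cdiff_order k U g.
Proof.
elim: k => // k IH U g w oU gw; split=> [x Ux|v].
  by apply: (@diff_near_cst _ _ _ w); near=> y; apply: gw; near: y; exact: open_nbhs_nbhs.
apply: (IH _ _ 0) => // x Ux.
rewrite (@near_eq_derive _ _ _ g (cst w)) ?derive_cst //.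
by near=> y; apply: gw; near: y; exact: open_nbhs_nbhs.
Unshelve. all: by end_near. Qed.

Lemma cdiff_id (V : normedModType C) k (U : set V) (g : V -> V) :
  open U -> (forall x, U x -> g x = x) -> cdiff_order k U g.
Proof.
case: k => // k oU gx; split=> [x Ux|v].
  by apply: diff_near_id; near=> y; apply: gx; near: y; exact: open_nbhs_nbhs.
apply: (@cdiff_cst _ _ _ _ _ v) => // x Ux.
rewrite (@near_eq_derive _ _ _ g id) ?derive_id //.
by near=> y; apply: gx; near: y; exact: open_nbhs_nbhs.
Unshelve. all: by end_near. Qed.

Lemma global_compat (p q : T) :
  holomorphic_on
    (cmap (global_chart p) @` (cdom (global_chart p) `&` cdom (global_chart q)))
    (cmap (global_chart q) \o cinv (global_chart p)).
Proof.
rewrite setTI; split=> // k; apply: cdiff_id => // _ [x _ <-].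
by rewrite /= gK.
Qed.

Definition global_atlas : atlas T :=
  @Atlas T n global_chart (fun=> I) global_compat.

Lemma global_hausdorff : hausdorff_space (atop global_atlas).
Proof.
rewrite open_hausdorff => p q pq.
have fpq : f p != f q by apply: contra_neq pq => /finj.
have := @norm_hausdorff _ 'rV[C]_n.
rewrite open_hausdorff => /(_ _ _ fpq)[XY [Xp Yq] [oX oY XY0]].
have opre (Z : set 'rV[C]_n) : open Z -> aopen (A := global_atlas) (f @^-1` Z).
  move=> oZ r /=; rewrite setIT (_ : _ @` _ = Z `&` range f); first exact: openI.
  apply/seteqP; split=> [_ [x Zx <-]|y [Zy [x _ xy]]]; first by split.
  by exists x; rewrite /= ?xy.
exists (f @^-1` XY.1, f @^-1` XY.2) => /=; first by move: Xp Yq; rewrite !inE.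
by split; [exact: opre|exact: opre|rewrite -preimage_setI (eqP XY0) preimage_set0].
Qed.

Definition global_structure : complex_structure T :=
  ComplexStructure global_hausdorff.

End GlobalChart.

Section VectorSpaces.
Context (V : vectType C).

Lemma open_range_v2r : open (range (v2r : V -> 'rV[C]_(dim V))).
Proof.
rewrite (_ : range _ = setT); first exact: openT.
by apply/seteqP; split=> // y _; exists (r2v y) => //; exact: r2vK.
Qed.

Definition vspace_structure : complex_structure V :=
  global_structure (@v2r_inj _ V) open_range_v2r.

Definition nonzero := {v : V | v != 0}.

Definition coord (v : nonzero) : 'rV[C]_(dim V) := v2r (val v).

Lemma coord_inj : injective coord.
Proof. by move=> u v /v2r_inj /val_inj. Qed.

Lemma open_range_coord : open (range coord).
Proof.
rewrite (_ : range _ = ~` [set 0]).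
  apply/closed_openC/accessible_closed_set1/hausdorff_accessible.
  exact: norm_hausdorff.
apply/seteqP; split=> [_ [v _ <-] /=|y /= /eqP y0].
  rewrite /coord -(linear0 v2r) => /v2r_inj; exact/eqP/(valP v).
have ry0 : r2v y != 0 :> V by rewrite -(linear0 r2v) (inj_eq (@r2v_inj _ V)).
by exists (Sub (r2v y) ry0) => //; rewrite /coord /= r2vK.
Qed.

Definition nonzero_structure : complex_structure nonzero :=
  global_structure coord_inj open_range_coord.

Definition projsp := {L : {vspace V} | \dim L == 1%N}.

Lemma dim_line (v : nonzero) : \dim <[val v]>%VS == 1%N.
Proof. by rewrite dim_vline (valP v). Qed.

Definition pr (v : nonzero) : projsp := Sub <[val v]>%VS (dim_line v).

Definition normsq (herm : {dot V for @Num.conj C}) (v : V) : R :=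
  complex.Re (herm v v).

(* The complex structure SP of P(V) is the one for which pr is a submersion. *)
Definition is_fubini_study (SP : complex_structure projsp)
    (herm : {dot V for @Num.conj C}) (Phi : form2 SP) :=
  is_form2 Phi /\
  forall v u w, pullback nonzero_structure SP pr Phi v u w =
    - 2 * 'i *
    deldelbar nonzero_structure (fun v => (ln (normsq herm (val v)))%:C) v u w.

End VectorSpaces.
End Manifolds.
Arguments local_rep {R S T} A B f p.
Arguments holo_at {R S T} A B f p.
Arguments holo {R S T} A B f.
Arguments mderiv {R S T} A B f p.
Arguments submersion {R S T} A B pi.
Arguments pullback {R S T} A B f w.
Arguments deldelbar {R T} A h.

Section LieGroups.
Context {R : realType}.
Local Notation C := R[i].
Context {G : groupType} (A : complex_structure (R := R) G).
Local Open Scope group_scope.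

Definition is_lie_group :=
  (forall g h : G,
    {for (g, h), continuous
      (fun x : atop A * atop A => ((x.1 : G) * (x.2 : G) : atop A))} /\
    exists W, W (cmap (chart_at A g) g, cmap (chart_at A h) h) /\
      holomorphic_on W (fun z : 'rV[C]_(adim A) * 'rV[C]_(adim A) =>
        cmap (chart_at A (g * h))
          (cinv (chart_at A g) z.1 * cinv (chart_at A h) z.2))) /\
  holo A A (fun g : G => g^-1).

Definition liealg := 'rV[C]_(adim A).

Local Notation e_chart := (chart_at A (1 : G)).
Local Notation e_coord := (cmap e_chart (1 : G)).

(* the left-invariant vector field with value X at 1, in the chart at 1 *)
Definition left_invariant (X : liealg) (x : liealg) : liealg :=
  'D_X (fun y => cmap e_chart (cinv e_chart x * cinv e_chart y)) e_coord.

Definition lie (X Y : liealg) : liealg :=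
  ('D_X (left_invariant Y) e_coord - 'D_Y (left_invariant X) e_coord)%R.

Definition lie_comm (U W : {vspace liealg}) : {vspace liealg} :=
  <<[seq lie x y | x <- vbasis U, y <- vbasis W]>>%VS.

Definition subalgebra (U : {vspace liealg}) :=
  forall x y, x \in U -> y \in U -> lie x y \in U.

Definition ideal (U : {vspace liealg}) :=
  forall x y, y \in U -> lie x y \in U.

Definition solvable (U : {vspace liealg}) :=
  exists k, iter k (fun W => lie_comm W W) U = 0%VS.

Definition nilpotent (U : {vspace liealg}) :=
  exists k, iter k (lie_comm U) U = 0%VS.

Definition semisimple := forall U, ideal U -> solvable U -> U = 0%VS.

Definition cartan_subalgebra (h : {vspace liealg}) :=
  [/\ subalgebra h, nilpotent h &
      forall x, (forall y, y \in h -> lie x y \in h) -> x \in h].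

Definition linear_span (S : set liealg) : set liealg :=
  [set x | forall U : {vspace liealg}, (forall y, S y -> y \in U) -> x \in U].

Definition generated_subalgebra (S : set liealg) : set liealg :=
  [set x | forall U : {vspace liealg},
    subalgebra U -> (forall y, S y -> y \in U) -> x \in U].

Section Roots.
Context (h : {vspace liealg}).
Local Notation hdual := 'Hom(subvs_of h, C^o).

Definition root_space (a : hdual) : set liealg :=
  [set x | forall y : subvs_of h, lie (vsval y) x = (a y *: x)%R].

Definition is_root (a : hdual) :=
  a <> 0%R /\ exists2 x, x <> 0%R & root_space a x.

Definition nonneg_comb (r : nat) (alpha : 'I_r -> hdual) (a : hdual) :=
  exists n : 'I_r -> nat, a = (\sum_i alpha i *+ n i)%R.

Definition simple_roots (r : nat) (alpha : 'I_r -> hdual) :=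
  [/\ basis_of fullv [seq alpha i | i : 'I_r],
      forall i, is_root (alpha i) &
      forall b, is_root b -> nonneg_comb alpha b \/ nonneg_comb alpha (- b)%R].

End Roots.

(* Cartan and Chevalley generators; r is the rank.  The Cartan matrix is
   k j i = alpha_j(h_i), the h_i being the simple coroots. *)
Record chevalley (r : nat) := Chevalley {
  cartan : {vspace liealg};
  sroot : 'I_r -> 'Hom(subvs_of cartan, C^o);
  hgen : 'I_r -> subvs_of cartan;
  xpos : 'I_r -> liealg;
  xneg : 'I_r -> liealg;
  cmx : 'M[int]_r;
  cartanP : cartan_subalgebra cartan;
  dim_cartan : \dim cartan = r;
  srootP : simple_roots sroot;
  xposP : forall i, root_space (sroot i) (xpos i);
  xnegP : forall i, root_space (- sroot i)%R (xneg i);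
  cmxE : forall i j, sroot j (hgen i) = ((cmx j i)%:~R)%R;
  cmx_diag : forall i, cmx i i = 2%R;
  lie_hx : forall i j,
    lie (vsval (hgen i)) (xpos j) = ((cmx j i)%:~R *: xpos j)%R;
  lie_hy : forall i j,
    lie (vsval (hgen i)) (xneg j) = (- ((cmx j i)%:~R *: xneg j))%R;
  lie_xy : forall i j,
    lie (xpos i) (xneg j) = if i == j then vsval (hgen i) else 0%R
}.

Section BorelParabolic.
Context {r : nat} (D : chevalley r).

Definition borel_subalgebra : set liealg :=
  linear_span ([set` cartan D] `|`
    [set x | exists2 b, is_root b /\ nonneg_comb (@sroot r D) b &
                        root_space b x]).

Definition parabolic_subalgebra (i : 'I_r) : set liealg :=
  generated_subalgebra (borel_subalgebra `|` [set xneg D j | j in [set~ i]]).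

End BorelParabolic.

(* The Lie algebra of a closed subgroup H: the velocities X of the
   one-parameter subgroups z |-> exp(z X) with exp(t X) in H for t real. *)
Definition lie_algebra_of (H : set G) : set liealg :=
  [set X | exists gam : C -> G,
    [/\ holo (vspace_structure C) A gam,
        forall s t, gam (s + t)%R = gam s * gam t,
        mderiv (vspace_structure C) A gam 0%R (v2r (1%R : C)) = X &
        forall t : R, H (gam t%:C)]].

Definition closed_connected_subgroup (H : set G) :=
  [/\ H 1, forall g h, H g -> H h -> H (g * h), forall g, H g -> H g^-1,
      closed (H : set (atop A)) & connected (H : set (atop A))].

Definition is_borel {r : nat} (D : chevalley r) (B : set G) :=
  closed_connected_subgroup B /\ lie_algebra_of B = borel_subalgebra D.

Definition is_parabolic {r : nat} (D : chevalley r) (i : 'I_r) (P : set G) :=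
  closed_connected_subgroup P /\ lie_algebra_of P = parabolic_subalgebra D i.

End LieGroups.
Arguments cartan {R G A r} c.
Arguments hgen {R G A r} c i.
Arguments xpos {R G A r} c i.
Arguments xneg {R G A r} c i.

Section Cosets.
Context {G : groupType}.
Local Open Scope group_scope.

Definition lcoset_space (H : set G) :=
  {X : set G | exists g, X = [set g * x | x in H]}.

Definition lcoset_proj (H : set G) (g : G) : lcoset_space H :=
  exist _ [set g * x | x in H] (ex_intro _ g erefl).

Definition lcoset_repr (H : set G) (X : lcoset_space H) : G :=
  projT1 (cid (proj2_sig X)).

(* g H |-> g K, where H is contained in K *)
Definition lcoset_map (H K : set G) (X : lcoset_space H) : lcoset_space K :=
  lcoset_proj K (lcoset_repr X).

End Cosets.

Section Representations.
Context {R : realType}.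
Local Notation C := R[i].
Context {G : groupType} (A : complex_structure (R := R) G) (V : vectType C).
Local Open Scope group_scope.

Record representation := Representation {
  rho :> G -> 'End(V);
  rho1 : rho 1 = \1%VF;
  rhoM : forall g h, rho (g * h) = (rho g \o rho h)%VF;
  rho_holo : holo A (vspace_structure 'End(V)) rho
}.

Implicit Type rho : representation.

Definition irreducible rho :=
  forall U : {vspace V}, (forall g, (rho g @: U <= U)%VS) ->
    U = 0%VS \/ U = fullv.

Definition drho rho (X : liealg A) : 'End(V) :=
  @r2v _ 'End(V) (mderiv A (vspace_structure 'End(V)) rho 1 X).

Lemma lker_rho rho g : lker (rho g) == 0%VS.
Proof.
apply/lker0P => u v e.
have K w : rho g^-1 (rho g w) = w.
  by rewrite -[LHS]comp_lfunE -rhoM mulVg rho1 id_lfunE.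
by rewrite -(K u) e K.
Qed.

Lemma dim_proj_act rho g (L : projsp V) : \dim (rho g @: val L)%VS == 1%N.
Proof.
by rewrite limg_dim_eq ?(valP L) // (eqP (lker_rho rho g)) capv0.
Qed.

Definition proj_act rho g (L : projsp V) : projsp V :=
  Sub (rho g @: val L)%VS (dim_proj_act rho g L).

Definition fundamental {r : nat} (D : chevalley A r) (i : 'I_r) rho
    (v : nonzero V) :=
  [/\ irreducible rho,
      forall j, drho rho (vsval (hgen D j)) (val v) =
                if i == j then val v else 0%R &
      forall j, drho rho (xpos D j) (val v) = 0%R].

(* g P |-> g . p, for p in P(V) with stabilizer P *)
Definition orbit_map rho (P : set G) (p : projsp V) (X : lcoset_space P) :
    projsp V :=
  proj_act rho (lcoset_repr X) p.

End Representations.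

(* Main.v *)
Require Import Defs.
From HB Require Import structures.
From mathcomp Require Import all_boot all_order all_algebra.
From mathcomp Require Import sesquilinear.
From mathcomp Require Import all_classical all_reals all_analysis.
From mathcomp Require Import complex.
From mathcomp Require Import ring lra.
Set Implicit Arguments.
Unset Strict Implicit.
Unset Printing Implicit Defensive.
Import Order.TTheory GRing.Theory Num.Theory.
Import numFieldNormedType.Exports VectorInternalTheory.
Local Open Scope classical_set_scope.
Local Open Scope ring_scope.
Local Open Scope complex_scope.

(* On the domain of the lift, the composite M -> P(V_i) equals pr o F, where
   F q = rho_i(lift q) v_i.  The maps G/B -> G/P_i -> P(V_i) are differentiable
   because they admit differentiable expressions through local sections of the
   projections from G, so the chain rule identifies Phi_i with the pullback
   under F of pr^* Phi_FS, which is -2i del delbar ln |v|^2 on V_i \ {0}.  That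
   del delbar commutes with the pullback under F follows from the explicit value
     del_u delbar_w ln |F|^2
       = <dF u, dF w> / |F|^2 - <F, dF w> <dF u, F> / |F|^4,
   valid for holomorphic F and depending on F only through F(x) and dF(x): it
   is applied once to F and once to the identity of V_i. *)

(** * Derivatives of complex-valued functions of a real variable *)

Section Curves.
Context {R : realType}.
Local Notation C := R[i].
Local Notation Re := (@complex.Re R).
Local Notation Im := (@complex.Im R).
Implicit Types (g h : R -> C) (l m : C).

Lemma continuous_Re : continuous (Re : C -> R).
Proof.
move=> z; apply/(@cvgrPdist_lt _ _ _ (nbhs (z : C))) => e e0.
near=> y.
have : `|z - y| < e%:C by near: y; apply: (nbhsx_ballx z e%:C); rewrite ltcR.
move=> /(le_lt_trans (normc_ge_Re _)); rewrite ltcR; congr (`|_| < e).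
by case: (z) (y) => [a b] [c d].
Unshelve. all: by end_near. Qed.

Lemma continuous_Im : continuous (Im : C -> R).
Proof.
rewrite (_ : Im = (fun z : C => Re (- 'i * z))); last first.
  by apply/funext => -[a b]; simpc.
move=> z; apply: (@continuous_comp C C R ( *%R (- 'i : C)) Re).
  exact: mulrl_continuous.
exact: continuous_Re.
Qed.

Lemma continuous_real_complex : continuous (real_complex R : R -> C).
Proof.
move=> x; apply/cvgrPdist_lt => e e0.
have eE : e = (Re e)%:C.
  by case: e e0 => a b; rewrite ltcE /= => /andP[/eqP ->].
near=> y; rewrite -rmorphB normc_def /= expr0n /= addr0 sqrtr_sqr eE ltcR.
near: y; apply: (nbhsx_ballx x).
by rewrite -ltcR -eE.
Unshelve. all: by end_near. Qed.

(** Real and imaginary parts are kept apart as in [rderive]; the base point is 0 because functions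
    are differentiated along the lines [x + t%:C *: v]. *)
Definition is_cderive g l :=
  is_derive (0 : R) 1 (fun t => Re (g t)) (Re l) /\
  is_derive (0 : R) 1 (fun t => Im (g t)) (Im l).

Lemma is_cderive_cst l : is_cderive (cst l) 0.
Proof. by split; exact: is_derive_cst. Qed.

Lemma is_cderiveD g h l m :
  is_cderive g l -> is_cderive h m -> is_cderive (fun t => g t + h t) (l + m).
Proof.
move=> [gR gI] [hR hI]; split.
  rewrite raddfD (_ : (fun t => _) = (Re \o g) + (Re \o h)).
    exact: is_deriveD.
  by apply/funext => t; rewrite /= raddfD.
rewrite raddfD (_ : (fun t => _) = (Im \o g) + (Im \o h)).
  exact: is_deriveD.
by apply/funext => t; rewrite /= raddfD.
Qed.

Lemma is_cderive_sum (I : Type) (s : seq I) (g : I -> R -> C) (l : I -> C) :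
  (forall i, is_cderive (g i) (l i)) ->
  is_cderive (fun t => \sum_(i <- s) g i t) (\sum_(i <- s) l i).
Proof.
move=> gl; elim: s => [|i s IH].
  rewrite big_nil (_ : (fun t => _) = cst 0); first exact: is_cderive_cst.
  by apply/funext => t; rewrite big_nil.
rewrite big_cons (_ : (fun t => _) = fun t => g i t + \sum_(j <- s) g j t).
  exact: is_cderiveD.
by apply/funext => t; rewrite big_cons.
Qed.

Lemma is_cderiveM g h l m : is_cderive g l -> is_cderive h m ->
  is_cderive (fun t => g t * h t) (l * h 0 + g 0 * m).
Proof.
move=> [gR gI] [hR hI]; split.
  rewrite (_ : (fun t => _) = (Re \o g) * (Re \o h) -
                              (Im \o g) * (Im \o h)).
    apply: is_derive_eq.
    rewrite /= /GRing.scale /=.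
    case: (l) (m) (g 0) (h 0) => [a b] [c d] [a' b'] [c' d'] /=; ring.
  by apply/funext => t /=; rewrite !fctE /=; case: (g t) (h t) => [a b] [c d].
rewrite (_ : (fun t => _) = (Re \o g) * (Im \o h) +
                            (Im \o g) * (Re \o h)).
  apply: is_derive_eq.
  rewrite /= /GRing.scale /=.
  case: (l) (m) (g 0) (h 0) => [a b] [c d] [a' b'] [c' d'] /=; ring.
by apply/funext => t /=; rewrite !fctE /=; case: (g t) (h t) => [a b] [c d] /=.
Qed.

Lemma is_cderiveZ (a : C) g l :
  is_cderive g l -> is_cderive (fun t => a * g t) (a * l).
Proof.
move=> gl; have := is_cderiveM (is_cderive_cst a) gl.
by rewrite mul0r add0r.
Qed.

Lemma is_cderive_conj g l :
  is_cderive g l -> is_cderive (fun t => (g t)^*) l^*.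
Proof.
move=> [gR gI]; split.
  rewrite (_ : Re l^* = Re l); last by case: (l).
  rewrite (_ : (fun t => _) = fun t => Re (g t)) //.
  by apply/funext => t; case: (g t).
rewrite (_ : Im l^* = - Im l); last by case: (l).
rewrite (_ : (fun t => _) = - (fun t => Im (g t))); first exact: is_deriveN.
by apply/funext => t; rewrite fctE; case: (g t).
Qed.

Lemma is_cderive_real (f : R -> R) (a : R) :
  is_derive (0 : R) 1 f a -> is_cderive (fun t => (f t)%:C) a%:C.
Proof. by move=> fa; split => //; exact: is_derive_cst. Qed.

(** Restricting the complex difference quotient to real increments gives the real directional
    derivative, so [rderive] can be computed from the complex differential. *)
Lemma is_cderive_line (V : normedModType C) (f : V -> C) (x v : V) :
  differentiable f x -> is_cderive (fun t => f (x + t%:C *: v)) ('d f x v).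
Proof.
move=> df.
have := @diff_derivable _ _ _ _ _ v df => /(@derivableP _ _ _ _ _ _).
have := deriveE v df => <- Df.
have cv : (fun h : R => h%:C^-1 *: (f (h%:C *: v + x) - f x)) @ 0^' --> 'D_v f x.
  have := @ex_derive _ _ _ _ _ _ _ Df.
  rewrite /derivable /derive => cf.
  have rc : (fun h : R => h%:C) @ 0^' --> ((0 : C)^').
    move=> Q Q0.
    have Q1 : nbhs (0 : R) (fun t => t%:C != 0 -> Q t%:C).
      exact: (continuous_real_complex Q0).
    apply: (filterS _ Q1) => t Qt t0; apply: Qt.
    by rewrite (inj_eq (@complexI R)).
  exact: (cvg_comp _ _ rc cf).
(* A continuous real-linear [p] passes through the difference quotient and its limit; [Re] and [Im]
   are the two cases needed. *)
have E (p : {additive C -> R}) : (forall (a : R) z, p (a%:C * z) = a * p z) ->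
   continuous (p : C -> R) ->
   is_derive (0 : R) 1 (fun t => p (f (x + t%:C *: v))) (p ('D_v f x)).
  move=> pZ pc.
  have cp : (fun h : R => h^-1 *: (p (f (x + (h *: 1 + 0 : R)%:C *: v)) -
       p (f (x + 0%:C *: v)))) @ 0^' --> p ('D_v f x).
    have := cvg_comp _ _ cv (pc _).
    apply: cvg_trans; apply: near_eq_cvg; near=> h => /=.
    rewrite -fmorphV [h *: _]mulr1 addr0 scale0r addr0 -raddfB.
    by rewrite (addrC x); exact: pZ.
  split; first by apply/cvg_ex; exists (p ('D_v f x)).
  exact: cvg_lim cp.
split; apply: (E (_ : {additive C -> R})).
- by move=> a [b c]; simpc.
- exact: continuous_Re.
- by move=> a [b c]; simpc.
- exact: continuous_Im.
Unshelve. all: by end_near. Qed.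
End Curves.

(** * Derivatives of the logarithm of a hermitian norm *)

Section LogNorm.
Context {R : realType}.
Local Notation C := R[i].
Local Notation Re := (@complex.Re R).
Context {V : vectType C} (herm : {dot V for @Num.conj C}).

Lemma herm_conj (a b : V) : herm a b = (herm b a)^*%C.
Proof. by rewrite hermC expr0 mul1r. Qed.

Lemma hermZl (k : C) (a b : V) : herm (k *: a) b = k * herm a b.
Proof. exact: linearZl_LR. Qed.

Lemma hermZr (k : C) (a b : V) : herm a (k *: b) = k^*%C * herm a b.
Proof. by rewrite herm_conj hermZl rmorphM [in RHS]herm_conj. Qed.

Lemma normsqE (a : V) : (normsq herm a)%:C = herm a a.
Proof.
rewrite /normsq; have := herm_conj a a.
by case: (herm a a) => x y [] /= yN; have -> : y = 0 by lra.
Qed.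

Lemma normsq_gt0 (a : V) : a != 0 -> 0 < normsq herm a.
Proof. by move=> a0; rewrite -ltcR normsqE; exact: neq0_dnorm_gt0. Qed.

Context {n : nat}.
Implicit Types (x y u w : 'rV[C]_n).

(** Expanding in the basis that [r2v] transports from the standard one leaves scalar functions with
    constant coefficients, to which the sum and product rules apply. *)
Lemma herm_sum (a b : 'rV[C]_(dim V)) : herm (r2v a) (r2v b) =
  \sum_j a 0 j *
    \sum_k (b 0 k)^*%C * herm (r2v (delta_mx 0 j)) (r2v (delta_mx 0 k)).
Proof.
rewrite {1}(row_sum_delta a) linear_sum linear_sumlz; apply: eq_bigr => j _.
rewrite linearZ /= hermZl; congr (_ * _).
rewrite {1}(row_sum_delta b) linear_sum linear_sumr; apply: eq_bigr => k _.
by rewrite linearZ /= hermZr.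
Qed.

Lemma addr_conj (a : C) : a + a^*%C = (Re (a + a^*%C))%:C.
Proof. by case: a => a b; congr (_ +i* _); rewrite subrr. Qed.

Lemma is_cderive_herm (a b : R -> 'rV[C]_(dim V)) (da db : 'rV[C]_(dim V)) :
  (forall j, is_cderive (fun t => a t 0 j) (da 0 j)) ->
  (forall j, is_cderive (fun t => b t 0 j) (db 0 j)) ->
  is_cderive (fun t => herm (r2v (a t)) (r2v (b t)))
    (herm (r2v da) (r2v (b 0)) + herm (r2v (a 0)) (r2v db)).
Proof.
move=> Da Db; rewrite !herm_sum -big_split /=.
under eq_fun do rewrite herm_sum.
apply: is_cderive_sum => j; apply: is_cderiveM => //.
apply: is_cderive_sum => k.
rewrite mulrC; under eq_fun do rewrite mulrC.
by apply: is_cderiveZ; exact: is_cderive_conj.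
Qed.

Lemma is_cderive_row m (F : 'rV[C]_n -> 'rV[C]_m) x u j :
  differentiable F x ->
  is_cderive (fun t => F (x + t%:C *: u) 0 j) ('d F x u 0 j).
Proof.
move=> dF; pose p : 'rV[C]_m -> C := fun a => a 0 j.
have dp z : differentiable p z by exact: differentiable_coord.
have pl : linear p by move=> a b c; rewrite /p !mxE.
(* A coordinate, packaged as a linear map, is its own differential; the chain rule then reads off
   the coordinate of ['d F x u]. *)
pose L : {linear 'rV[C]_m -> C} := HB.pack p (GRing.isLinear.Build _ _ _ _ p pl).
have Lc : continuous L by move=> z; exact: differentiable_continuous.
have dL : 'd p (F x) = p :> (_ -> _) by exact: (@diff_lin _ _ _ L (F x) Lc).
have <- : 'd (p \o F) x u = 'd F x u 0 j.
  by rewrite diff_comp //; exact: (congr1 (fun f : _ -> C => f ('d F x u)) dL).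
by apply: is_cderive_line; exact: differentiable_comp.
Qed.

Section Composite.
Context (F : 'rV[C]_n -> 'rV[C]_(dim V)).
Local Notation Q y := (normsq herm (r2v (F y))).

Lemma is_derive_normsq y u : differentiable F y ->
  let A := herm (r2v ('d F y u)) (r2v (F y)) in
  is_derive (0 : R) 1 (fun t => Q (y + t%:C *: u)) (Re (A + A^*%C)).
Proof.
move=> dF A.
have [+ _] := is_cderive_herm (fun j => is_cderive_row u j dF)
  (fun j => is_cderive_row u j dF).
by rewrite scale0r addr0 [X in _ + X]herm_conj -/A.
Qed.

Lemma r2v_neq0 (a : 'rV[C]_(dim V)) : (r2v a != 0 :> V) = (a != 0).
Proof. by rewrite -(linear0 r2v) (inj_eq (@r2v_inj _ V)). Qed.

Lemma is_cderive_ln_normsq y u : differentiable F y -> F y != 0 ->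
  let A := herm (r2v ('d F y u)) (r2v (F y)) in
  is_cderive (fun t => (ln (Q (y + t%:C *: u)))%:C) ((A + A^*%C) / (Q y)%:C).
Proof.
move=> dF F0 A.
have y0 : y + (0 : R)%:C *: u = y by rewrite scale0r addr0.
have Fy0 : r2v (F y) != 0 by rewrite r2v_neq0.
have -> : (A + A^*%C) / (Q y)%:C = ((Q y)^-1 * Re (A + A^*%C))%:C.
  rewrite rmorphM fmorphV mulrC; congr (_ * _).
  exact: addr_conj.
apply: is_cderive_real; apply: (is_derive1_comp (f := @ln R)); last first.
  exact: is_derive_normsq.
by rewrite y0; apply: is_derive1_ln; exact: normsq_gt0.
Qed.

Lemma mulii : ('i : C) * 'i = -1.
Proof. by rewrite -expr2 sqr_i. Qed.

Lemma conjcMi (a : C) : ('i * a)^*%C = - ('i * a^*%C).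
Proof. by rewrite rmorphM /= -mulNr; congr (_ * _); simpc. Qed.

Lemma rderiveE (f : 'rV[C]_n -> C) x u l :
  is_cderive (fun t => f (x + t%:C *: u)) l -> rderive f x u = l.
Proof.
by move=> [Dr Di]; rewrite /rderive !derive1E !derive_val; case: (l).
Qed.

Lemma near_line x v (P : set 'rV[C]_n) :
  (\forall y \near x, P y) -> \forall t \near (0 : R), P (x + t%:C *: v).
Proof.
move=> Px.
have c0 : (fun t : R => x + t%:C *: v) @ (0 : R) --> x + (0 : R)%:C *: v.
  apply: cvgD; first exact: cvg_cst.
  by apply: cvgZr_tmp; exact: continuous_real_complex.
by apply: c0; rewrite /= scale0r addr0.
Qed.

Lemma rderive_near (f g : 'rV[C]_n -> C) x v :
  (\forall y \near x, f y = g y) -> rderive f x v = rderive g x v.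
Proof.
move=> /(near_line v) fg; rewrite /rderive !derive1E.
congr (_ +i* _); apply: near_eq_derive; near=> t; by rewrite (near fg t).
Unshelve. all: by end_near. Qed.

(** Put A = <dF w, F>. As dF is complex linear, passing from [w] to ['i *: w] turns A + conj A into
    i A - i conj A, and the combination in [delbar0] keeps only conj A = <F, dF w>. *)
Lemma delbar0_ln_normsq y w : differentiable F y -> F y != 0 ->
  delbar0 (fun z => (ln (Q z))%:C) y w =
  herm (r2v (F y)) (r2v ('d F y w)) / (Q y)%:C.
Proof.
move=> dF F0; rewrite /delbar0.
rewrite (rderiveE (is_cderive_ln_normsq w dF F0)).
rewrite (rderiveE (is_cderive_ln_normsq ('i *: w) dF F0)).
rewrite !linearZ /= hermZl [herm (r2v (F y)) _]herm_conj.
set A := herm _ _; set q := (Q y)%:C^-1.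
rewrite conjcMi; set B := A^*%C.
have -> : 'i * (('i * A - 'i * B) * q) = ('i * 'i) * ((A - B) * q) by ring.
by rewrite mulii; field.
Qed.

(** The quotient rule, to be used with [E y = 'd F y w]. The terms <F, dE u> and <F, dF u> are
    antilinear in [u], so [del0] removes them. *)
Lemma del0_herm_div (E : 'rV[C]_n -> 'rV[C]_(dim V)) x u :
  differentiable F x -> differentiable E x -> F x != 0 ->
  del0 (fun y => herm (r2v (F y)) (r2v (E y)) / (Q y)%:C) x u =
  herm (r2v ('d F x u)) (r2v (E x)) / (Q x)%:C -
  herm (r2v (F x)) (r2v (E x)) * herm (r2v ('d F x u)) (r2v (F x)) /
    (Q x)%:C ^+ 2.
Proof.
move=> dF dE F0; have Fx0 : r2v (F x) != 0 by rewrite r2v_neq0.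
have Q0 : 0 < Q x by exact: normsq_gt0.
(* [W a b] is the value of the quotient rule when [F] and [E] have directional derivatives [a] and
   [b]. *)
pose W (a b : 'rV[C]_(dim V)) := let A := herm (r2v a) (r2v (F x)) in
  (herm (r2v a) (r2v (E x)) + herm (r2v (F x)) (r2v b)) / (Q x)%:C -
  herm (r2v (F x)) (r2v (E x)) * (A + A^*%C) / (Q x)%:C ^+ 2 : C.
have D v a b : 'd F x v = a -> 'd E x v = b ->
    rderive (fun y => herm (r2v (F y)) (r2v (E y)) / (Q y)%:C) x v = W a b.
  move=> <- <-; rewrite /W; set A := herm _ (r2v (F x)); apply: rderiveE.
  have x0 : x + (0 : R)%:C *: v = x by rewrite scale0r addr0.
  have D1 := is_cderive_herm (fun j => is_cderive_row v j dF)
    (fun j => is_cderive_row v j dE).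
  have Qx0 : Q (x + (0 : R)%:C *: v) != 0 by rewrite x0 gt_eqF.
  have D2 := is_cderive_real (is_deriveV Qx0 (is_derive_normsq v dF)).
  under eq_fun do rewrite -fmorphV.
  have := is_cderiveM D1 D2; rewrite !x0.
  congr is_cderive; rewrite -/A fmorphV; congr (_ + _).
  rewrite [in RHS]addr_conj /GRing.scale /= rmorphM rmorphN /=.
  by rewrite fmorphV rmorphXn /=; ring.
have aZ : 'd F x ('i *: u) = 'i *: 'd F x u by exact: linearZZ.
have bZ : 'd E x ('i *: u) = 'i *: 'd E x u by exact: linearZZ.
rewrite /del0 (D _ _ _ erefl erefl) (D _ _ _ aZ bZ) {D aZ bZ}.
suff WE dFu dEu : (W dFu dEu - 'i * W ('i *: dFu) ('i *: dEu)) / 2 =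
    herm (r2v dFu) (r2v (E x)) / (Q x)%:C -
    herm (r2v (F x)) (r2v (E x)) * herm (r2v dFu) (r2v (F x)) / (Q x)%:C ^+ 2.
  exact: WE.
rewrite /W.
move: (F x) (E x) Q0 {F0 Fx0 dF dE W} => Fx Ex Q0.
have rZ (z : 'rV[C]_(dim V)) : r2v ('i *: z) = 'i *: r2v z :> V.
  exact: linearZZ.
rewrite !rZ !hermZl hermZr.
set a := herm (r2v dFu) (r2v Ex); set b := herm (r2v Fx) (r2v dEu).
set c := herm (r2v Fx) (r2v Ex); set d := herm (r2v dFu) (r2v Fx).
rewrite conjcMi; set d' := d^*%C.
have -> : ('i : C)^*%C = - 'i by simpc.
set q := (normsq herm (r2v Fx))%:C.
have q0 : q != 0 by rewrite gt_eqF // ltcR.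
(* The square of i is kept as the factor ['i * 'i], since [field] treats ['i] as an indeterminate;
   [mulii] evaluates it afterwards. *)
transitivity (((a + b) / q - c * (d + d') / q ^+ 2 -
    (('i * 'i) * (a - b) / q - ('i * 'i) * c * (d - d') / q ^+ 2)) / 2).
  by congr (_ / _); field.
by rewrite mulii; field.
Qed.

Lemma del0_delbar0_ln_normsq x u w :
  (\forall y \near x, differentiable F y) ->
  differentiable (fun y => 'd F y w) x -> F x != 0 ->
  let q := (Q x)%:C in
  del0 (fun y => delbar0 (fun z => (ln (Q z))%:C) y w) x u =
  herm (r2v ('d F x u)) (r2v ('d F x w)) / q -
  herm (r2v (F x)) (r2v ('d F x w)) * herm (r2v ('d F x u)) (r2v (F x)) / q ^+ 2.
Proof.
move=> dF ddF F0 q.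
have H := del0_herm_div u (nbhs_singleton dF) ddF F0.
transitivity (del0 (fun y => herm (r2v (F y)) (r2v ('d F y w)) / (Q y)%:C) x u);
  last exact: H.
(* The formula for [delbar0] must hold on a whole neighbourhood of [x] before it is differentiated;
   continuity keeps [F] away from 0 there. *)
have F0' : \forall y \near x, F y != 0.
  have Fc := differentiable_continuous (nbhs_singleton dF).
  have N0 : nbhs (F x) (~` [set 0]).
    apply: open_nbhs_nbhs; split; last exact/eqP.
    apply/closed_openC/accessible_closed_set1/hausdorff_accessible.
    exact: norm_hausdorff.
  have N1 : \forall y \near x, (~` [set 0]) (F y) by exact: (Fc _ N0).
  by near=> y; apply/eqP; near: y.
rewrite /del0; congr ((_ - 'i * _) / 2); apply: rderive_near; near=> y;
  (apply: delbar0_ln_normsq; near: y; [exact: dF|exact: F0']).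
Unshelve. all: by end_near. Qed.
End Composite.
End LogNorm.

(** * Differentiability in charts and its locality *)

Section Charts.
Context {R : realType}.
Local Notation C := R[i].

Lemma near_eq_differentiable {U W : normedModType C} (f g : U -> W) x :
  (\forall y \near x, f y = g y) -> differentiable f x -> differentiable g x.
Proof.
(* The difference [g - f] vanishes near [x], hence is differentiable there. *)
move=> fg df; have -> : g = f + (g - f).
  by apply/funext => y; rewrite !fctE addrC subrK.
apply: differentiableD => //; apply: (@diff_near_cst _ _ _ _ 0).
by near=> y; rewrite !fctE (near fg y) // subrr.
Unshelve. all: by end_near. Qed.

Lemma near_eq_diff {U W : normedModType C} (f g : U -> W) x :
  (\forall y \near x, f y = g y) -> differentiable f x -> 'd f x =1 'd g x.
Proof.
move=> fg df v; have dg := near_eq_differentiable fg df.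
have Df := deriveE v df.
have Dg := deriveE v dg.
apply: etrans (esym Df) _.
apply: etrans _ Dg.
exact: near_eq_derive.
Qed.

Context {S T : Type} (A : complex_structure (R := R) S)
  (B : complex_structure (R := R) T).

(** Openness in an atlas means openness of all chart images, and on the image of a chart domain
    [cinv] recovers the point. *)
Lemma near_chart {X : Type} (K : complex_structure (R := R) X)
    (Y : set (atop K)) p :
  nbhs (p : atop K) Y -> \forall y \near cmap (chart_at K p) p,
    cdom (chart_at K p) (cinv (chart_at K p) y) /\ Y (cinv (chart_at K p) y).
Proof.
rewrite nbhsE => -[Z [oZ Zp] ZY].
apply: (filterS _ (_ : nbhs _
  (cmap (chart_at K p) @` ((Z : set X) `&` cdom (chart_at K p))))).
  by move=> _ [x [Zx cx] <-]; rewrite cmapK //; split => //; exact: ZY.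
apply: open_nbhs_nbhs; split; first exact: oZ.
by exists p => //; split => //; exact: mem_chart_at.
Qed.

(** The first clause keeps the image inside the domain of the target chart, where [cinv] inverts
    [cmap]; this is what lets local representatives compose. *)
Definition mdiff (f : S -> T) p :=
  (\forall y \near cmap (chart_at A p) p,
     cdom (chart_at B (f p)) (f (cinv (chart_at A p) y))) /\
  differentiable (local_rep A B f p) (cmap (chart_at A p) p).

Lemma nbhs_cdom {X : Type} (K : complex_structure (R := R) X) p :
  nbhs (p : atop K) (cdom (chart_at K p)).
Proof.
apply: open_nbhs_nbhs; split; last exact: mem_chart_at.
move=> q; have [opn _] := chart_compat K q p.
by rewrite setIC.
Qed.

Lemma continuous_near_cdom (f : S -> T) p :
  {for p, continuous (f : atop A -> atop B)} ->
  \forall y \near cmap (chart_at A p) p,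
     cdom (chart_at B (f p)) (f (cinv (chart_at A p) y)).
Proof.
move=> cf; have fX : nbhs (p : atop A) (f @^-1` cdom (chart_at B (f p))).
  exact: (cf _ (@nbhs_cdom _ B (f p))).
by apply: filterS (near_chart fX) => y [].
Qed.

Lemma holo_at_mdiff f p : holo_at A B f p -> mdiff f p.
Proof.
move=> [cf [Y [Yp [_ /(_ 1%N)[dY _]]]]]; split; last exact: dY.
exact: continuous_near_cdom.
Qed.

Lemma mdiff_near (f g : S -> T) p (X : set (atop A)) :
  nbhs (p : atop A) X -> (forall q, X q -> f q = g q) -> mdiff f p ->
  mdiff g p /\ mderiv A B f p =1 mderiv A B g p.
Proof.
move=> Xp fg [fB df].
(* Equality at [p] itself makes both local representatives use the same target chart. *)
have gp : g p = f p by rewrite fg //; exact: nbhs_singleton Xp.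
have E : \forall y \near cmap (chart_at A p) p,
    local_rep A B f p y = local_rep A B g p y.
  apply: filterS (near_chart Xp) => y [_ Xy].
  by rewrite /local_rep /= gp (fg _ Xy).
split; last by move=> u; exact: (near_eq_diff E df).
split; last exact: near_eq_differentiable df.
rewrite gp; apply: filterS2 fB (near_chart Xp) => y fy [_ Xy].
by rewrite -(fg _ Xy).
Qed.
End Charts.

(** * The chain rule for maps of manifolds *)

Section Chain.
Context {R : realType}.
Context {S T W : Type} (A : complex_structure (R := R) S)
  (B : complex_structure (R := R) T) (D : complex_structure (R := R) W).

Lemma mdiff_comp (f : S -> T) (g : T -> W) p :
  mdiff A B f p -> mdiff B D g (f p) ->
  mdiff A D (g \o f) p /\
  mderiv A D (g \o f) p =1 mderiv B D g (f p) \o mderiv A B f p.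
Proof.
move=> [fB df] [gD dg].
have fpE :
    local_rep A B f p (cmap (chart_at A p) p) = cmap (chart_at B (f p)) (f p).
  by rewrite /local_rep /= cmapK //; exact: mem_chart_at.
have dg' : differentiable (local_rep B D g (f p))
    (local_rep A B f p (cmap (chart_at A p) p)).
  by rewrite fpE.
(* The composite of the representatives is compared with the representative of the composite only
   near the base point, where [cmapK] applies. *)
have E : \forall y \near cmap (chart_at A p) p,
    (local_rep B D g (f p) \o local_rep A B f p) y = local_rep A D (g \o f) p y.
  by apply: filterS fB => y fy; rewrite /local_rep /= cmapK.
have dgf := differentiable_comp df dg'.
split; last first.
  move=> u; have E1 := near_eq_diff E dgf u.
  have E2 := congr1 (fun h => h u) (diff_comp df dg').
  apply: etrans (esym E1) _; apply: etrans E2 _.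
  exact: (congr1 (fun z => 'd (local_rep B D g (f p)) z (mderiv A B f p u)) fpE).
split; last exact: near_eq_differentiable dgf.
have cf : local_rep A B f p @ cmap (chart_at A p) p -->
    cmap (chart_at B (f p)) (f p).
  by rewrite -fpE; exact: differentiable_continuous.
apply: filterS2 fB (cf _ gD) => y fy /=.
by rewrite cmapK.
Qed.
End Chain.

(** * Second-order differentiability *)

Section TwiceDifferentiable.
Context {R : realType}.
Local Notation C := R[i].

Lemma differentiable_sum_fun (V W : normedModType C) n (f : 'I_n -> V -> W) x :
  (forall i, differentiable (f i) x) ->
  differentiable (fun y => \sum_(i < n) f i y) x.
Proof.
move=> df; rewrite (_ : (fun y => _) = \sum_(i < n) f i).
  exact: differentiable_sum.
by apply/funext => y; rewrite fct_sumE.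
Qed.

Lemma differentiable_entry (V : normedModType C) m (f : V -> 'rV[C]_m) x j :
  differentiable f x -> differentiable (fun y => f y 0 j : C) x.
Proof.
move=> df; apply: (differentiable_comp (g := fun a : 'rV[C]_m => a 0 j : C) df).
exact: differentiable_coord.
Qed.

Lemma differentiable_scale (V : normedModType C) m (k : V -> C)
    (f : V -> 'rV[C]_m) x :
  differentiable k x -> differentiable f x ->
  differentiable (fun y => k y *: f y) x.
Proof.
move=> dk df.
rewrite (_ : (fun y => _) = fun y => \sum_j (k y * f y 0 j) *: 'e_j).
  apply: differentiable_sum_fun => j.
  apply: (@differentiableZl _ _ _ (fun y => k y * f y 0 j)).
  apply: (@differentiableM _ _ k (fun y => f y 0 j)) => //.
  exact: differentiable_entry.
apply/funext => y; rewrite {1}(row_sum_delta (f y)) scaler_sumr.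
by apply: eq_bigr => j _; rewrite scalerA.
Qed.

Lemma differentiable_linear_row m k (L : {linear 'rV[C]_m -> 'rV[C]_k}) x :
  differentiable L x.
Proof.
rewrite (_ : (L : _ -> _) = fun y => \sum_j y 0 j *: L 'e_j).
  apply: differentiable_sum_fun => j.
  apply: (@differentiableZl _ _ _ (fun y : 'rV[C]_m => y 0 j : C)).
  exact: differentiable_coord.
apply/funext => y; rewrite {1}(row_sum_delta y) linear_sum.
by apply: eq_bigr => j _; exact: linearZZ.
Qed.

(** This is the regularity that [del0_delbar0_ln_normsq] asks of [F], in a form stable under
    composition. *)
Definition twice_diff {n m} (f : 'rV[C]_n -> 'rV[C]_m) x :=
  (\forall y \near x, differentiable f y) /\
  forall w, differentiable (fun y => 'd f y w) x.

Lemma holomorphic_twice_diff n m (f : 'rV[C]_n -> 'rV[C]_m) x U :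
  U x -> holomorphic_on U f -> twice_diff f x.
Proof.
move=> Ux [oU /(_ 2%N)[df ddf]].
have Un : \forall y \near x, U y by exact: open_nbhs_nbhs.
split; first by apply: filterS Un => y; exact: df.
move=> w; have [dw _] := ddf w.
apply: near_eq_differentiable (dw _ Ux).
by apply: filterS Un => y Uy; exact: (deriveE w (df _ Uy)).
Qed.

Lemma twice_diff_near n m (f g : 'rV[C]_n -> 'rV[C]_m) x :
  (\forall y \near x, f y = g y) -> twice_diff f x -> twice_diff g x.
Proof.
(* The differential at [y] depends on values near [y], so [f] and [g] must agree near every [y]
   close to [x]. *)
move=> fg [df ddf]; have fg2 := near_join fg.
split.
  by apply: filterS2 fg2 df => y; exact: near_eq_differentiable.
move=> w; apply: near_eq_differentiable (ddf w).
by apply: filterS2 fg2 df => y e d; exact: (near_eq_diff e d).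
Qed.

Lemma twice_diff_linear m k (L : {linear 'rV[C]_m -> 'rV[C]_k}) x :
  twice_diff L x.
Proof.
split.
  by apply: (@filterE _ (nbhs x)) => y; exact: differentiable_linear_row.
move=> w; rewrite (_ : (fun y => _) = cst (L w)); first exact: differentiable_cst.
apply/funext => y.
have Lc : continuous L.
  by move=> z; exact/differentiable_continuous/differentiable_linear_row.
exact: (congr1 (fun h : _ -> _ => h w) (diff_lin y Lc)).
Qed.

Lemma twice_diff_comp n m k (f : 'rV[C]_n -> 'rV[C]_m)
    (g : 'rV[C]_m -> 'rV[C]_k) x :
  twice_diff f x -> twice_diff g (f x) -> twice_diff (g \o f) x.
Proof.
move=> [df ddf] [dg ddg].
have fc : f @ x --> f x by exact: differentiable_continuous (nbhs_singleton df).
have dgf : \forall y \near x, differentiable g (f y) by exact: (fc _ dg).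
split; first by apply: filterS2 df dgf => y; exact: differentiable_comp.
move=> w.
(* This is the differential of [g \o f] in the direction [w], with ['d f y w] expanded in the
   standard basis. Each summand is a product of differentiable functions, so no operator-valued map
   has to be differentiated. *)
pose h := fun y => \sum_j ('d f y w) 0 j *: 'd g (f y) 'e_j.
apply: (@near_eq_differentiable _ _ _ h).
  apply: filterS2 df dgf => y dfy dgy.
  apply: etrans _ (esym (congr1 (fun h => h w) (diff_comp dfy dgy))).
  rewrite /= /h.
  move: ('d g (f y)) => L; move: ('d f y w) => a.
  rewrite [in RHS](row_sum_delta a) linear_sum.
  by apply: eq_bigr => j _; symmetry; exact: linearZZ.
apply: differentiable_sum_fun => j.
apply: differentiable_scale.
  apply: (differentiable_entry (f := fun y => 'd f y w)); exact: ddf.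
apply: (differentiable_comp (nbhs_singleton df) (g := fun z => 'd g z 'e_j)).
exact: ddg.
Qed.
End TwiceDifferentiable.

(** * Coset representatives *)

Section Cosets.
Context {G : groupType}.
Local Open Scope group_scope.

(** The chosen representative g' satisfies g'H = gH, and it lies in g'H because H contains 1. *)
Lemma lcoset_repr_proj (H : set G) g : H 1 ->
  exists2 h, H h & lcoset_repr (lcoset_proj H g) = g * h.
Proof.
move=> H1; rewrite /lcoset_repr; case: cid => g' /= E.
have : [set g' * x | x in H] g' by exists 1 => //; exact: mulg1.
by rewrite -E => -[h Hh <-]; exists h.
Qed.

Lemma lcoset_projM (H : set G) g h : (forall x y, H x -> H y -> H (x * y)) ->
  (forall x, H x -> H x^-1) -> H h -> lcoset_proj H (g * h) = lcoset_proj H g.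
Proof.
move=> HM HV Hh; apply: eq_exist; apply/seteqP; split=> _ [x Hx <-].
  by exists (h * x); [exact: HM|rewrite mulgA].
by exists (h^-1 * x); [apply: HM => //; exact: HV|rewrite -mulgA mulVKg].
Qed.

Lemma lcoset_mapE (H K : set G) g : H 1 -> H `<=` K ->
  (forall x y, K x -> K y -> K (x * y)) -> (forall x, K x -> K x^-1) ->
  lcoset_map K (lcoset_proj H g) = lcoset_proj K g.
Proof.
move=> H1 HK KM KV; rewrite /lcoset_map.
have [h Hh ->] := lcoset_repr_proj g H1.
by apply: lcoset_projM => //; exact: HK.
Qed.

End Cosets.

(** * Orbits of a vector and of its line under a representation *)

Section OrbitVector.
Context {R : realType}.
Local Notation C := R[i].
Context {G : groupType} (A : complex_structure (R := R) G) (V : vectType C).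
Context (rho : representation A V) (v : nonzero V).

Lemma rho_neq0 g : rho g (val v) != 0.
Proof.
have /lker0P inj := lker_rho rho g.
apply: contra_neq (valP v) => e; apply: inj.
by rewrite e linear0.
Qed.

Definition orbit_vector (g : G) : nonzero V := Sub (rho g (val v)) (rho_neq0 g).

Lemma proj_act_pr g : proj_act rho g (pr v) = pr (orbit_vector g).
Proof. by apply: val_inj; rewrite /= limg_line. Qed.

Lemma proj_actM g h L :
  proj_act rho (g * h)%g L = proj_act rho g (proj_act rho h L).
Proof. by apply: val_inj; rewrite /= rhoM limg_comp. Qed.

(** The chosen representative differs from [g] by an element of [P], which fixes the line of [v]. *)
Lemma orbit_mapE (P : set G) g : P 1%g ->
  (forall h, P h -> proj_act rho h (pr v) = pr v) ->
  orbit_map rho (pr v) (lcoset_proj P g) = pr (orbit_vector g).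
Proof.
move=> P1 Pv; rewrite /orbit_map; have [h Ph ->] := lcoset_repr_proj g P1.
by rewrite proj_actM Pv // proj_act_pr.
Qed.

(** Evaluation at [v] in coordinates: a linear map through which the regularity of [rho] passes to
    [orbit_vector]. *)
Definition eval_coord (a : 'rV[C]_(dim 'End(V))) : 'rV[C]_(dim V) :=
  v2r ((r2v a : 'End(V)) (val v)).

Lemma eval_coord_linear : linear eval_coord.
Proof.
move=> k a b; rewrite /eval_coord linearP /=.
by rewrite add_lfunE scale_lfunE linearP.
Qed.

HB.instance Definition _ := GRing.isLinear.Build C 'rV[C]_(dim 'End(V))
  'rV[C]_(dim V) *:%R eval_coord eval_coord_linear.

Lemma orbit_vector_coord g :
  Defs.coord (orbit_vector g) = eval_coord (v2r (rho g : 'End(V))).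
Proof. by rewrite /Defs.coord /eval_coord v2rK. Qed.

Lemma mdiff_orbit_vector g : mdiff A (nonzero_structure V) orbit_vector g.
Proof.
(* Charts of [nonzero V] have the whole space as domain, so the first clause of [mdiff] is
   trivial. *)
split; first by apply: (@filterE _ (nbhs _)).
rewrite (_ : local_rep A (nonzero_structure V) orbit_vector g =
  eval_coord \o local_rep A (vspace_structure 'End(V)) rho g
  :> ('rV[C]_(adim A) -> 'rV[C]_(dim V))).
  have [_ dr] := holo_at_mdiff (rho_holo rho g).
  by apply: differentiable_comp => //; exact: differentiable_linear_row.
by apply/funext => y; exact: orbit_vector_coord.
Qed.

Lemma twice_diff_orbit_vector {M : Type} (S : complex_structure (R := R) M)
    (f : M -> G) p : holo_at S A f p ->
  twice_diff (local_rep S (nonzero_structure V) (orbit_vector \o f) p)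
    (cmap (chart_at S p) p).
Proof.
move=> hf; have [cf [W [Wp hW]]] := hf.
have fB := continuous_near_cdom cf.
have [_ [W' [Wp' hW']]] := rho_holo rho (f p).
pose L := local_rep A (vspace_structure 'End(V)) rho (f p).
(* Near the base point the map is [f], then [rho], then evaluation at [v], each read in charts. *)
apply: (@twice_diff_near _ _ _ ((eval_coord \o L) \o local_rep S A f p)).
  apply: filterS fB => y fy.
  by rewrite /L /local_rep /= cmapK // orbit_vector_coord.
apply: twice_diff_comp; first exact: holomorphic_twice_diff Wp hW.
rewrite (_ : local_rep S A f p _ = cmap (chart_at A (f p)) (f p)); last first.
  by rewrite /local_rep /= cmapK //; exact: mem_chart_at.
apply: twice_diff_comp (holomorphic_twice_diff Wp' hW') _.
exact: twice_diff_linear.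
Qed.
End OrbitVector.

(** * Descent of differentiability along a submersion *)

Section Descend.
Context {R : realType}.
Context {S T W : Type} (A : complex_structure (R := R) S)
  (B : complex_structure (R := R) T) (D : complex_structure (R := R) W).

(** Near [pi p], [f] is [g] composed with a local section through [p]. This handles maps on coset
    spaces, which are defined through arbitrary representatives. *)
Lemma mdiff_descend (pi : S -> T) (f : T -> W) (g : S -> W) p :
  submersion A B pi -> (forall s, f (pi s) = g s) -> mdiff A D g p ->
  mdiff B D f (pi p).
Proof.
move=> [_ /(_ p)[U [s [oU Up sp Us]]]] fg dg.
have [_ hs] := Us _ Up.
have dg' : mdiff A D g (s (pi p)) by rewrite sp.
have [dgs _] := mdiff_comp (holo_at_mdiff hs) dg'.
have NU : nbhs (pi p : atop B) (U : set (atop B)) by exact: open_nbhs_nbhs.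
have gf y : (U : set (atop B)) y -> (g \o s) y = f y.
  by move=> Uy; have [e _] := Us _ Uy; rewrite /= -fg e.
by have [] := mdiff_near NU gf dgs.
Qed.
End Descend.

(** * Pullback of del delbar ln |v|^2 *)

Section DelDelbarLogNorm.
Context {R : realType}.
Local Notation C := R[i].

Lemma delbar0_near n (f g : 'rV[C]_n -> C) x v :
  (\forall y \near x, f y = g y) -> delbar0 f x v = delbar0 g x v.
Proof. by move=> fg; rewrite /delbar0 !(rderive_near _ fg). Qed.

Lemma del1_delbar0_near n (f g : 'rV[C]_n -> C) x u w :
  (\forall y \near x, f y = g y) ->
  del1 (delbar0 f) x u w = del1 (delbar0 g) x u w.
Proof.
move=> /near_join fg.
have E v : \forall y \near x, delbar0 f y v = delbar0 g y v.
  by apply: filterS fg => y; exact: delbar0_near.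
have Ed v a :
    del0 (fun y => delbar0 f y v) x a = del0 (fun y => delbar0 g y v) x a.
  have e1 := rderive_near a (E v).
  have e2 := rderive_near ('i *: a) (E v).
  exact: (congr2 (fun s t : C => (s - 'i * t) / 2) e1 e2).
exact: (congr2 (fun s t : C => s - t) (Ed w u) (Ed u w)).
Qed.

Context {V : vectType C} (herm : {dot V for @Num.conj C}).

Lemma deldelbar_ln_normsq_comp {M : Type} (S : complex_structure (R := R) M)
    (f : M -> nonzero V) p u w :
  twice_diff (local_rep S (nonzero_structure V) f p) (cmap (chart_at S p) p) ->
  deldelbar S (fun q => (ln (normsq herm (val (f q))))%:C) p u w =
  deldelbar (nonzero_structure V) (fun a => (ln (normsq herm (val a)))%:C) (f p)
    (mderiv S (nonzero_structure V) f p u) (mderiv S (nonzero_structure V) f p w).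
Proof.
set x := cmap _ p.
pose F : 'rV[C]_(adim S) -> 'rV[C]_(dim V) :=
  local_rep S (nonzero_structure V) f p.
move=> [dF ddF].
have Fx : F x = v2r (val (f p)).
  by rewrite /F /local_rep /= cmapK //; exact: mem_chart_at.
have F0 : F x != 0.
  rewrite Fx; apply: contra_neq (valP (f p)) => e.
  by apply: (@v2r_inj _ V); rewrite e linear0.
have EF : (fun q => (ln (normsq herm (val (f q))))%:C) \o cinv (chart_at S p) =
    fun y => (ln (normsq herm (r2v (F y))))%:C.
  by apply/funext => y; rewrite /F /local_rep /= /Defs.coord v2rK.
(* The map [ginv] inverts the chart only on the nonzero vectors, an open set containing [F x];
   elsewhere it returns the default point [f p]. *)
have E1 : \forall z \near F x,
    ((fun a : nonzero V => (ln (normsq herm (val a)))%:C) \o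
      (cinv (chart_at (nonzero_structure V) (f p)) : 'rV[C]_(dim V) -> _)) z =
    (ln (normsq herm (r2v (idfun z))))%:C.
  have N : nbhs (F x) (range (@Defs.coord R V)).
    apply: open_nbhs_nbhs; split; first exact: open_range_coord.
    by exists (f p).
  apply: filterS N => _ [a _ <-] /=.
  by rewrite (gK (@coord_inj R V)) /Defs.coord v2rK.
have [did ddid] := twice_diff_linear (@idfun 'rV[C]_(dim V)) (F x).
have dE a : 'd (@idfun 'rV[C]_(dim V)) (F x) a = a.
  have idc : continuous (@idfun 'rV[C]_(dim V)) by move=> z; exact: cvg_id.
  exact: (congr1 (fun h : _ -> _ => h a) (diff_lin (F x) idc)).
pose h (G : 'rV[C]_(dim V)) := (ln (normsq herm (r2v G)))%:C.
(* Both sides have the same explicit value, since [idfun] has value [F x] and identity differential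
   at [F x]. Antisymmetrizing in the two directions then gives [del1]. *)
have K a b : del0 (fun y => delbar0 (h \o F) y b) x a =
    del0 (fun y => delbar0 (h \o idfun) y ('d F x b)) (F x) ('d F x a).
  apply: etrans (del0_delbar0_ln_normsq herm a dF (ddF b) F0) _.
  apply: etrans _ (esym (del0_delbar0_ln_normsq herm _ did (ddid ('d F x b)) F0)).
  by rewrite (dE ('d F x a)) (dE ('d F x b)).
have zE : F x = cmap (chart_at (nonzero_structure V) (f p)) (f p) by exact: Fx.
have L := del1_delbar0_near ('d F x u) ('d F x w) E1.
rewrite zE in L.
rewrite /deldelbar -/x EF.
apply: etrans (congr2 (fun s t : C => s - t) (K u w) (K w u)) _.
rewrite zE.
exact: (esym L).
Qed.
End DelDelbarLogNorm.

(** * The forms [Phi i] along a local lift *)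

Theorem proposition4p1 (R : realType)
  (* M, of complex dimension 1 *)
  (M : Type) (SM : complex_structure (R := R) M) (dimM : adim SM = 1%N)
  (* G, of rank r *)
  (G : groupType) (SG : complex_structure (R := R) G)
  (lieG : is_lie_group SG) (connG : connected [set: atop SG])
  (ssG : semisimple SG)
  (r : nat) (D : chevalley SG r)
  (* the fundamental representations *)
  (V : 'I_r -> vectType R[i]) (rho : forall i, representation SG (V i))
  (v : forall i, nonzero (V i))
  (fundV : forall i, fundamental D i (rho i) (v i))
  (herm : forall i, {dot (V i) for @Num.conj R[i]})
  (* B_+ and F_- = G / B_+ *)
  (B : set G) (borelB : is_borel D B)
  (SF : complex_structure (R := R) (lcoset_space B))
  (submF : submersion SG SF (lcoset_proj B))
  (* P_{+i'} and F_{-i} = G / P_{+i'} *)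
  (P : 'I_r -> set G) (parabP : forall i, is_parabolic D i (P i))
  (subBP : forall i, B `<=` P i)
  (stabP : forall i, P i = [set g | proj_act (rho i) g (pr (v i)) = pr (v i)])
  (SFi : forall i, complex_structure (R := R) (lcoset_space (P i)))
  (submFi : forall i, submersion SG (SFi i) (lcoset_proj (P i)))
  (* P(V_i) and the Fubini-Study forms *)
  (SP : forall i, complex_structure (R := R) (projsp (V i)))
  (submP : forall i, submersion (nonzero_structure (V i)) (SP i) (@pr R (V i)))
  (PhiFS : forall i, form2 (SP i))
  (FS : forall i, is_fubini_study (herm i) (PhiFS i))
  (* phi_- and the forms Phi_i *)
  (phi : M -> lcoset_space B) (holo_phi : holo SM SF phi)
  (Phi : 'I_r -> form2 SM)
  (PhiE : forall i, Phi i =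
    pullback SM SF phi
      (pullback SF (SFi i) (@lcoset_map G B (P i))
        (pullback (SFi i) (SP i) (orbit_map (rho i) (pr (v i))) (PhiFS i))))
  (* a local lift; its values outside of U are irrelevant *)
  (U : set M) (openU : open (U : set (atop SM)))
  (lift : M -> G) (holo_lift : forall p, U p -> holo_at SM SG lift p)
  (liftE : forall p, U p -> lcoset_proj B (lift p) = phi p) :
  forall (i : 'I_r) (p : M), U p ->
  forall u w : 'rV[R[i]]_(adim SM),
    Phi i p u w =
    - 2 * 'i *
    deldelbar SM
      (fun q => (ln (normsq (herm i) (rho i (lift q) (val (v i)))))%:C) p u w.
Proof.
move=> i p Up u w.
have [[B1 _ _ _ _] _] := borelB.
have [[P1 PM PV _ _] _] := parabP i.
have Pv h : P i h -> proj_act (rho i) h (pr (v i)) = pr (v i) by rewrite stabP.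
pose orb := orbit_map (P := P i) (rho i) (pr (v i)).
pose lcm := @lcoset_map G B (P i).
pose ov := orbit_vector (rho i) (v i).
have lcmE g : lcm (lcoset_proj B g) = lcoset_proj (P i) g.
  exact: lcoset_mapE (subBP i) PM PV.
have orbE g : orb (lcoset_proj (P i) g) = pr (ov g) by exact: orbit_mapE.
have dphi := holo_at_mdiff (holo_phi p).
(* Composed with G -> G/B, the map [lcm] becomes the holomorphic projection G -> G/P_i, so it
   descends. *)
have dlcm : mdiff SF (SFi i) lcm (phi p).
  rewrite -(liftE _ Up); apply: mdiff_descend submF lcmE _.
  by have [hP _] := submFi i; exact: holo_at_mdiff (hP _).
have [hpr _] := submP i.
have dov g : mdiff SG (nonzero_structure (V i)) ov g by exact: mdiff_orbit_vector.
(* Composed with G -> G/P_i, the map [orb] becomes [pr] after [ov], which is differentiable by the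
   chain rule. *)
have dorb : mdiff (SFi i) (SP i) orb (lcm (phi p)).
  rewrite -(liftE _ Up) lcmE; apply: mdiff_descend (submFi i) orbE _.
  by have [] := mdiff_comp (dov (lift p)) (holo_at_mdiff (hpr _)).
have [dlp lpE] := mdiff_comp dphi dlcm.
have [dolp olpE] := mdiff_comp dlp dorb.
pose f := ov \o lift.
have [df _] := mdiff_comp (holo_at_mdiff (holo_lift _ Up)) (dov (lift p)).
have [dpf pfE] := mdiff_comp df (holo_at_mdiff (hpr (f p))).
have NU : nbhs (p : atop SM) (U : set (atop SM)) by exact: open_nbhs_nbhs.
have E q : U q -> (orb \o (lcm \o phi)) q = (@pr R (V i) \o f) q.
  by move=> Uq; rewrite /= -(liftE _ Uq) lcmE orbE.
have [_ dE] := mdiff_near NU E dolp.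
(* The chain rule along the two factorizations of the same map U -> P(V_i) equates the tangent
   vectors fed to [PhiFS i]. *)
have mE a : mderiv (SFi i) (SP i) orb (lcm (phi p))
      (mderiv SF (SFi i) lcm (phi p) (mderiv SM SF phi p a)) =
    mderiv (nonzero_structure (V i)) (SP i) (@pr R (V i)) (f p)
      (mderiv SM (nonzero_structure (V i)) f p a).
  apply: etrans _ (pfE a); apply: etrans _ (dE a).
  apply: etrans _ (esym (olpE a)).
  exact: congr1 (esym (lpE a)).
have [_ FSi] := FS i.
have -> : Phi i p u w = PhiFS i (pr (f p))
    (mderiv (nonzero_structure (V i)) (SP i) (@pr R (V i)) (f p)
      (mderiv SM (nonzero_structure (V i)) f p u))
    (mderiv (nonzero_structure (V i)) (SP i) (@pr R (V i)) (f p)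
      (mderiv SM (nonzero_structure (V i)) f p w)).
  rewrite PhiE /pullback -/orb -/lcm (mE u) (mE w); congr (PhiFS i _ _ _).
  exact: E.
(* The left side is now the pullback of [PhiFS i] under [pr] at [f p], so the Fubini-Study equation
   applies. It remains to pull del delbar back along [f], which is regular enough because the lift
   is holomorphic at [p]. *)
apply: etrans (FSi (f p) _ _) _.
have tf := twice_diff_orbit_vector (rho i) (v i) (holo_lift _ Up).
have L := deldelbar_ln_normsq_comp (herm i) u w tf.
exact: (congr1 (fun z => - 2 * 'i * z) (esym L)).
Qed.
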